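(* For each $n\in\mathbb N$ let $(F_n,R_n,\rho_n,\mu_n)$, and let $(F,R,\rho,\mu)$, be rooted-and-measured boundedly-compact metric spaces such that $(F_n,R_n)$ and $(F,R)$ are recurrent resistance metric spaces and the Radon measures $\mu_n$, $\mu$ are of full support. Let $(p_n(t,x,y))_{t>0,\,x,y\in F_n}$ be the jointly continuous transition density (with respect to $\mu_n$) of the process associated with $(F_n,R_n,\mu_n)$. Assume that $(F_n,R_n,\rho_n,\mu_n)$ converges to $(F,R,\rho,\mu)$ in the local Gromov-Hausdorff-vague topology. For $T,r,\delta>0$ put $K_n(T,r)=[T,\infty)\times D_{R_n}(\rho_n,r)\times D_{R_n}(\rho_n,r)$, where $D_{R_n}(\rho_n,r)$ is the closed ball, $$\mathfrak s_n(T,r)=\sup_{(t,x,y)\in K_n(T,r)}p_n(t,x,y),$$ $$\mathfrak d_n(T,r,\delta)=\sup\bigl\{|p_n(t,x,y)-p_n(t',x',y')|:(t,x,y),(t',x',y')\in K_n(T,r),\ |t-t'|\vee R_n(x,x')\vee R_n(y,y')\le\delta\bigr\}.$$ Then for any $T>0$ and $r>0$, $$\sup_{n\ge1}\mathfrak s_n(T,r)<\infty,\qquad\lim_{\delta\downarrow0}\sup_{n\ge1}\mathfrak d_n(T,r,\delta)=0.$$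
   Context: **Resistance forms.** A resistance form on a non-empty set $F$ is a pair $(\mathcal E,\mathcal F)$ with: (RF1) $\mathcal F$ a linear space of functions $F\to\mathbb R$ containing constants, $\mathcal E$ a non-negative symmetric bilinear form on $\mathcal F$ with $\mathcal E(f,f)=0$ iff $f$ is constant; (RF2) $\mathcal F$ modulo constants is a Hilbert space under $\mathcal E$; (RF3) $\mathcal F$ separates points; (RF4) $R(x,y):=\sup\{|f(x)-f(y)|^2/\mathcal E(f,f): f\in\mathcal F,\mathcal E(f,f)>0\}<\infty$; (RF5) $\bar f=(f\wedge1)\vee0\in\mathcal F$ and $\mathcal E(\bar f,\bar f)\le\mathcal E(f,f)$. A resistance metric is a metric arising as such an $R$; the form is then uniquely determined. For $A,B\subseteq F$, $R(A,B)=(\inf\{\mathcal E(f,f):f\in\mathcal F,f|_A\equiv1,f|_B\equiv0\})^{-1}$ ($0$ if no such $f$). A metric space is boundedly compact if all closed balls are compact. A boundedly-compact resistance metric space is recurrent if $\lim_{r\to\infty}R(\rho,B_R(\rho,r)^c)=\infty$ for some (equivalently any) $\rho$, $B_R$ denoting open balls. For such a space and a Radon measure $m$ (Borel, finite on compacts) of full support, letting $\mathcal D$ be the closure of $\mathcal F\cap C_c(F)$ under $\mathcal E(f,f)+\int f^2dm$, $(\mathcal E,\mathcal D)$ is a regular Dirichlet form on $L^2(F,m)$; the associated Hunt process (uniquely defined from every starting point) is called the process associated with $(F,R,m)$. It admits a unique jointly continuous transition density with respect to $m$. **Local Gromov-Hausdorff-vague topology.** For a rooted boundedly-compact $(S,d^S,\rho_S)$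 and $r>0$ put $S^{(r)}=\mathrm{cl}(B_S(\rho_S,r))$, $A^{(r)}=\mathrm{cl}(A\cap B_S(\rho_S,r))$ for closed $A$, $\mu^{(r)}=\mu(\cdot\cap S^{(r)})$ for Radon $\mu$. With $d_H^S$, $d_P^S$ the Hausdorff and Prohorov metrics, set $d_{\bar H}^{S,\rho_S}(A,B)=\int_0^\infty e^{-r}(1\wedge d_H^S(A^{(r)},B^{(r)}))dr$ and $d_V^{S,\rho_S}(\mu,\nu)=\int_0^\infty e^{-r}(1\wedge d_P^S(\mu^{(r)},\nu^{(r)}))dr$. The topology is induced by the metric (on classes up to root- and measure-preserving isometry) between $(S,d^S,\rho_S,\mu_S)$ and $(T,d^T,\rho_T,\mu_T)$ given by $\inf_{f,g,M}\{d_{\bar H}^{M,\rho_M}(f(S),g(T))\vee d_V^{M,\rho_M}(\mu_S\circ f^{-1},\mu_T\circ g^{-1})\}$, over rooted boundedly-compact $(M,d^M,\rho_M)$ and root-and-distance-preserving maps $f:S\to M$, $g:T\to M$. *)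

(* Defs.v *)
From HB Require Import structures.
From mathcomp Require Import all_boot all_order all_algebra.
From mathcomp Require Import all_classical all_reals all_analysis.
From mathcomp Require Import measurable_realfun.

Set Implicit Arguments.
Unset Strict Implicit.
Unset Printing Implicit Defensive.

Import Order.TTheory GRing.Theory Num.Theory.
Import numFieldNormedType.Exports.

Local Open Scope classical_set_scope.
Local Open Scope ring_scope.

(* A rooted metric space is a metric space that is also a pointed type: the
   root is [point]. *)
#[short(type="pmetricType")]
HB.structure Definition PMetric (K : numDomainType) :=
  { M of Pointed M & Metric K M }.

(* [closed_ball] of the library is the closure of the open ball, hence this
   separate definition. *)
Definition cball (R : realType) (X : metricType R) (x : X) (r : R) : set X :=
  [set y | mdist x y <= r].

Definition boundedly_compact (R : realType) (X : metricType R) : Prop :=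
  forall (x : X) (r : R), compact (cball x r).

Notation borel T := (g_sigma_algebraType (@open T)).

Definition radon (R : realType) (X : pmetricType R)
    (m : {measure set (borel X) -> \bar R}) : Prop :=
  forall K : set X, compact K -> (m K < +oo)%E.

Definition full_support (R : realType) (X : pmetricType R)
    (m : {measure set (borel X) -> \bar R}) : Prop :=
  forall U : set X, open U -> U !=set0 -> (0 < m U)%E.

(* Only the values of [energy] on [fdom] are relevant. *)
Record energy_form (R : realType) (X : Type) := EnergyForm {
  fdom : set (X -> R);
  energy : (X -> R) -> (X -> R) -> R }.

(* The value 0 is added because the supremum is over an empty set when the
   space has a single point. *)
Definition resistance (R : realType) (X : Type) (E : energy_form R X)
    (x y : X) : \bar R :=
  ereal_sup ([set 0%E] `|`
    [set (`|f x - f y| ^+ 2 / energy E f f)%:E | f in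
      [set f | fdom E f /\ 0 < energy E f f]]).

Record resistance_form (R : realType) (X : Type) (E : energy_form R X) :
    Prop := {
  rf1_cst : forall c : R, fdom E (cst c);
  rf1_linear : forall (a : R) f g, fdom E f -> fdom E g ->
    fdom E (fun x => a * f x + g x);
  rf1_bilinear : forall (a : R) f g h, fdom E f -> fdom E g -> fdom E h ->
    energy E (fun x => a * f x + g x) h = a * energy E f h + energy E g h;
  rf1_sym : forall f g, fdom E f -> fdom E g -> energy E f g = energy E g f;
  rf1_ge0 : forall f, fdom E f -> 0 <= energy E f f;
  rf1_eq0 : forall f, fdom E f -> energy E f f = 0 <-> exists c, f = cst c;
  rf2 : forall u : nat -> X -> R, (forall n, fdom E (u n)) ->
    (forall e : R, 0 < e -> exists N : nat, forall m n : nat,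
      (N <= m)%N -> (N <= n)%N -> energy E (u m \- u n) (u m \- u n) < e) ->
    exists2 f, fdom E f &
      energy E (u n \- f) (u n \- f) @[n --> \oo] --> (0 : R);
  rf3 : forall x y, x <> y -> exists2 f, fdom E f & f x <> f y;
  rf4 : forall x y, (resistance E x y < +oo)%E;
  rf5 : forall f, fdom E f ->
    let g := fun x => Num.max (Num.min (f x) 1) 0 in
    fdom E g /\ energy E g g <= energy E f f }.

Definition has_resistance_metric (R : realType) (X : metricType R)
    (E : energy_form R X) : Prop :=
  forall x y : X, resistance E x y = (mdist x y)%:E.

(* The infimum over the empty set is +oo, whose inverse is 0; the inverse of 0
   is +oo. *)
Definition set_resistance (R : realType) (X : Type) (E : energy_form R X)
    (A B : set X) : \bar R :=
  inve (ereal_inf [set (energy E f f)%:E | f in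
    [set f | [/\ fdom E f, forall x, A x -> f x = 1 &
                 forall x, B x -> f x = 0]]]).

Definition recurrent (R : realType) (X : metricType R)
    (E : energy_form R X) : Prop :=
  exists rho : X,
    set_resistance E [set rho] (~` ball rho r) @[r --> +oo%R] --> +oo%E.

Definition compact_support (R : realType) (X : metricType R) (f : X -> R) :
    Prop := compact (closure [set x | f x != 0]).

Definition dirichlet_domain (R : realType) (X : pmetricType R)
    (E : energy_form R X) (m : {measure set (borel X) -> \bar R}) :
    set (X -> R) :=
  [set f | [/\ fdom E f, (f : borel X -> R) \in Lfun m 2%:E &
    exists2 u : nat -> X -> R,
      (forall n, [/\ fdom E (u n), continuous (u n) & compact_support (u n)]) &
      ((energy E (u n \- f) (u n \- f))%:E
        + \int[m]_x ((u n x - f x) ^+ 2)%:E @[n --> \oo] --> 0)%E]].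

Definition L2_inner d (T : measurableType d) (R : realType)
    (m : {measure set T -> \bar R}) (f g : T -> R) : R :=
  \int[m]_x (f x * g x).

(* Elements of L^2 are given by square-integrable representatives. *)
Record L2_semigroup d (X : measurableType d) (R : realType)
    (m : {measure set X -> \bar R}) (T : R -> (X -> R) -> (X -> R)) : Prop := {
  sg_L2 : forall (t : R) f, 0 < t -> f \in Lfun m 2%:E -> T t f \in Lfun m 2%:E;
  sg_ae : forall (t : R) f g, 0 < t -> f \in Lfun m 2%:E -> g \in Lfun m 2%:E ->
    f = g %[ae m] -> T t f = T t g %[ae m];
  sg_linear : forall (t a : R) f g, 0 < t ->
    f \in Lfun m 2%:E -> g \in Lfun m 2%:E ->
    T t (fun x => a * f x + g x) = (fun x => a * T t f x + T t g x) %[ae m];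
  sg_semigroup : forall (s t : R) f, 0 < s -> 0 < t -> f \in Lfun m 2%:E ->
    T (s + t) f = T s (T t f) %[ae m];
  sg_contraction : forall (t : R) f, 0 < t -> f \in Lfun m 2%:E ->
    ('N[m]_2%:E[EFin \o T t f] <= 'N[m]_2%:E[EFin \o f])%E;
  sg_symmetric : forall (t : R) f g, 0 < t ->
    f \in Lfun m 2%:E -> g \in Lfun m 2%:E ->
    L2_inner m (T t f) g = L2_inner m f (T t g);
  sg_continuous : forall f, f \in Lfun m 2%:E ->
    ('N[m]_2%:E[EFin \o (T t f \- f)%R] @[t --> 0^'+] --> 0)%E }.

(* A symmetric strongly continuous contraction semigroup determines the form
   E(f, g) = lim_(t -> 0+) (f - T_t f, g) / t, whose domain consists of those f
   for which the limit of (f - T_t f, f) / t is finite (the quotient increases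
   as t decreases).  The semigroup of (E, D) is the one whose form is (E, D). *)
Record semigroup_of_form (R : realType) (X : pmetricType R)
    (E : energy_form R X) (m : {measure set (borel X) -> \bar R})
    (T : R -> (borel X -> R) -> (borel X -> R)) : Prop := {
  sgf_semigroup : L2_semigroup m T;
  sgf_domain : forall f : borel X -> R, f \in Lfun m 2%:E ->
    (exists2 u, dirichlet_domain E m u & f = u %[ae m]) <->
    cvg (t^-1 * L2_inner m (f \- T t f) f @[t --> 0^'+]);
  sgf_form : forall f g : borel X -> R,
    dirichlet_domain E m f -> dirichlet_domain E m g ->
    t^-1 * L2_inner m (f \- T t f) g @[t --> 0^'+] --> energy E f g }.

Definition stopping_time (Omega : Type) (R : realType)
    (M : R -> set (set Omega)) (sigma : Omega -> \bar R) : Prop :=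
  (forall w, (0 <= sigma w)%E) /\
  (forall t : R, 0 <= t -> M t [set w | (sigma w <= t%:E)%E]).

(* A Hunt process in the sense of Fukushima, Oshima and Takeda; [None] is the
   cemetery, and only the times t >= 0 are relevant in [hp_path t]. *)
Record hunt_process (R : realType) (X : pmetricType R) := HuntProcess {
  hp_display : measure_display;
  hp_Omega : measurableType hp_display;
  hp_law : one_point_compactification X -> probability hp_Omega R;
  hp_path : R -> hp_Omega -> one_point_compactification X;
  hp_filtration : R -> set (set hp_Omega);
  hp_shift : R -> hp_Omega -> hp_Omega;
  hp_filtration_sigma : forall t : R, 0 <= t ->
    sigma_algebra setT (hp_filtration t) /\ hp_filtration t `<=` measurable;
  hp_filtration_homo : forall s t : R, 0 <= s -> s <= t ->
    hp_filtration s `<=` hp_filtration t;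
  hp_filtration_right : forall t : R, 0 <= t ->
    \bigcap_(s in [set s | t < s]) hp_filtration s `<=` hp_filtration t;
  hp_adapted : forall (t : R) (B : set (borel (one_point_compactification X))),
    0 <= t -> measurable B -> hp_filtration t (hp_path t @^-1` B);
  hp_law_measurable :
    forall (t : R) (B : set (borel (one_point_compactification X))),
    0 <= t -> measurable B ->
    measurable_fun setT (fun x : borel (one_point_compactification X) =>
      hp_law x (hp_path t @^-1` B) : \bar R);
  hp_normal : forall x, hp_law x [set w | hp_path 0 w = x] = 1%E;
  hp_cemetery : forall t : R, 0 <= t ->
    hp_law None [set w | hp_path t w = None] = 1%E;
  hp_absorbed : forall (s t : R) w, 0 <= s -> s <= t ->
    hp_path s w = None -> hp_path t w = None;
  hp_shiftE : forall (s t : R) w, 0 <= s -> 0 <= t ->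
    hp_path s (hp_shift t w) = hp_path (t + s) w;
  hp_right_continuous : forall (t : R) w, 0 <= t ->
    hp_path s w @[s --> t^'+] --> hp_path t w;
  hp_left_limits : forall (t : R) w, 0 < t ->
    exists l : one_point_compactification X, hp_path s w @[s --> t^'-] --> l;
  (* The conditional-probability identity, integrated over the events A of the
     sigma-algebra of sigma and restricted to the event that sigma is finite;
     constant times give the simple Markov property. *)
  hp_strong_markov : forall (sigma : hp_Omega -> \bar R) x (s : R)
      (B : set (borel (one_point_compactification X))) (A : set hp_Omega),
    stopping_time hp_filtration sigma -> 0 <= s -> measurable B ->
    measurable A ->
    (forall t : R, 0 <= t ->
      hp_filtration t (A `&` [set w | (sigma w <= t%:E)%E])) ->
    (hp_law x [set w | [/\ A w, sigma w < +oo &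
                           B (hp_path (fine (sigma w) + s) w)]] =
     \int[hp_law x]_(w in A `&` [set w | sigma w < +oo])
        hp_law (hp_path (fine (sigma w)) w) (hp_path s @^-1` B))%E;
  hp_quasi_left_continuous : forall (sigma_ : nat -> hp_Omega -> \bar R)
      (sigma : hp_Omega -> \bar R) x,
    (forall n, stopping_time hp_filtration (sigma_ n)) ->
    (forall n w, (sigma_ n w <= sigma_ n.+1 w)%E) ->
    (forall w, sigma_ n w @[n --> \oo] --> sigma w) ->
    {ae hp_law x, forall w, (sigma w < +oo)%E ->
      hp_path (fine (sigma_ n w)) w @[n --> \oo]
        --> hp_path (fine (sigma w)) w} }.

(* Functions on X are extended by 0 at the cemetery. *)
Definition process_of_form (R : realType) (X : pmetricType R)
    (E : energy_form R X) (m : {measure set (borel X) -> \bar R})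
    (Y : hunt_process X) : Prop :=
  exists2 T : R -> (borel X -> R) -> (borel X -> R),
    semigroup_of_form E m T &
    forall (t : R) (f : borel X -> R), 0 < t -> f \in Lfun m 2%:E ->
      (exists C : R, forall x, `|f x| <= C) ->
      (fun x : borel X => \int[hp_law Y (Some x)]_w oapp f 0 (hp_path t w))
        = T t f %[ae m].

Definition transition_density (R : realType) (X : pmetricType R)
    (m : {measure set (borel X) -> \bar R}) (Y : hunt_process X)
    (p : R -> X -> X -> R) : Prop :=
  forall t : R, 0 < t ->
    (forall x y, 0 <= p t x y) /\
    (forall x, measurable_fun setT (p t x : borel X -> R)) /\
    (forall (x : X) (A : set (borel X)), measurable A ->
      hp_law Y (Some x) [set w | exists2 y, A y & hp_path t w = Some y] =
        \int[m]_(y in A) (p t x y)%:E)%E.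

Definition jointly_continuous (R : realType) (X : metricType R)
    (p : R -> X -> X -> R) : Prop :=
  forall (t : R) (x y : X), 0 < t ->
    {for (t, x, y), continuous (fun z : R * X * X => p z.1.1 z.1.2 z.2)}.

Definition thicken (R : realType) (M : metricType R) (A : set M) (e : R) :
    set M := [set x | exists2 y, A y & mdist x y < e].

Definition hausdorff_dist (R : realType) (M : metricType R) (A B : set M) :
    \bar R :=
  ereal_inf [set e%:E | e in [set e : R |
    [/\ 0 < e, A `<=` thicken B e & B `<=` thicken A e]]].

Definition prohorov_dist (R : realType) (M : pmetricType R)
    (mu nu : set (borel M) -> \bar R) : \bar R :=
  ereal_inf [set e%:E | e in [set e : R | 0 < e /\
    forall A : set (borel M), measurable A ->
      (mu A <= nu (thicken A e) + e%:E)%E /\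
      (nu A <= mu (thicken A e) + e%:E)%E]].

Definition restrict_set (R : realType) (M : pmetricType R) (r : R)
    (A : set M) : set M := closure (A `&` ball point r).

Definition restrict_measure (R : realType) (M : pmetricType R) (r : R)
    (mu : set (borel M) -> \bar R) : set (borel M) -> \bar R :=
  fun A => mu (A `&` closure (ball (point : M) r)).

Definition local_hausdorff_dist (R : realType) (M : pmetricType R)
    (A B : set M) : \bar R :=
  (\int[lebesgue_measure]_(r in `]0%R, +oo[)
    ((expR (- r))%:E *
     mine 1 (hausdorff_dist (restrict_set r A) (restrict_set r B))))%E.

Definition vague_dist (R : realType) (M : pmetricType R)
    (mu nu : set (borel M) -> \bar R) : \bar R :=
  (\int[lebesgue_measure]_(r in `]0%R, +oo[)
    ((expR (- r))%:E *
     mine 1 (prohorov_dist (restrict_measure r mu) (restrict_measure r nu))))%E.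

Definition rooted_isometric (R : realType) (S M : pmetricType R) (f : S -> M) :
    Prop :=
  f point = point /\ forall x y, mdist (f x) (f y) = mdist x y.

Definition ghv_dist (R : realType) (S T : pmetricType R)
    (muS : {measure set (borel S) -> \bar R})
    (muT : {measure set (borel T) -> \bar R}) : \bar R :=
  ereal_inf [set e | exists (M : pmetricType R) (f : S -> M) (g : T -> M),
    [/\ boundedly_compact M, rooted_isometric f, rooted_isometric g &
        e = maxe (local_hausdorff_dist (range f) (range g))
                 (vague_dist (pushforward muS (f : borel S -> borel M))
                             (pushforward muT (g : borel T -> borel M)))]].

Definition time_space_set (R : realType) (X : pmetricType R) (T r : R) :
    set (R * X * X) :=
  [set z | [/\ T <= z.1.1, cball point r z.1.2 & cball point r z.2]].

Definition density_sup (R : realType) (X : pmetricType R)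
    (p : R -> X -> X -> R) (T r : R) : \bar R :=
  ereal_sup [set (p z.1.1 z.1.2 z.2)%:E | z in @time_space_set R X T r].

Definition density_osc (R : realType) (X : pmetricType R)
    (p : R -> X -> X -> R) (T r delta : R) : \bar R :=
  ereal_sup [set e | exists z z' : R * X * X,
    [/\ time_space_set T r z, time_space_set T r z',
        Num.max `|z.1.1 - z'.1.1|
          (Num.max (mdist z.1.2 z'.1.2) (mdist z.2 z'.2)) <= delta &
        e = `|p z.1.1 z.1.2 z.2 - p z'.1.1 z'.1.2 z'.2|%:E]].

(* Main.v *)
Require Import Defs.
From HB Require Import structures.
From mathcomp Require Import all_boot all_order all_algebra.
From mathcomp Require Import all_classical all_reals all_analysis.
From mathcomp Require Import measurable_realfun.
From mathcomp Require Import ring lra.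
Import Order.TTheory GRing.Theory Num.Theory.
Import numFieldNormedType.Exports.
Local Open Scope classical_set_scope.
Local Open Scope ring_scope.

(** Write K_t(f, g) for the inner product of T_t f with g in L^2.

    Everything follows from an on-diagonal bound for the density which depends
    on the space only through a lower bound c for the mass of the ball of
    radius r around the root.

    The function K_t(f, f) of t is the squared norm of T_(t/2) f.  It is
    nonnegative, nonincreasing since T_t is a contraction, and midpoint convex
    since |u - v|^2 >= 0; being bounded above away from 0, it is convex
    ([midpoint_chord]).  Convexity controls its slopes, which gives
    - a representative of T_t f in the domain of the form, of energy at most
      K_t(f, f) / t ([semigroup_finite_energy]);
    - by polarization, |K_t(f, g) - K_(t+h)(f, g)| at most
      (h / t) (K_(t/2)(f, f) + K_(t/2)(g, g)) ([semigroup_inner_time]).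

    The density is recovered from K by testing with the normalized indicators
    of small balls: K_t(1_(B(x,d)) / m(B(x,d)), 1_(B(y,d)) / m(B(y,d))) tends
    to p_t(y, x) as d tends to 0, by joint continuity ([semigroup_avg_cvg]).
    Hence every inequality between values of K yields one between values of p
    at all points: symmetry, the estimate above in the time variable and,
    since |u(z) - u(w)|^2 <= R(z, w) E(u, u),
      |p_t(z, x) - p_t(w, x)|^2 <= R(z, w) p_t(x, x) / t ([density_space]).

    As p_t(x, .) integrates to at most 1, some y in the ball around the root
    has p_t(x, y) <= 2 / c, and the last estimate bounds p_t(x, x) in terms of
    p_t(x, y) and R(x, y) <= 2 r ([density_diag_le]).  Feeding this back into
    the two estimates bounds p and its modulus of continuity.

    Finally, vague convergence and the full support of the limit bound from
    below the mass of the balls of radius r around the roots, for all large n,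
    and full support of each measure takes care of the other n
    ([ghv_cvg_ball_lower_bound]). *)

(** * Midpoint convex functions *)

Definition midpoint_convex {R : realType} (phi : R -> R) : Prop :=
  forall a b, 0 < a -> 0 < b -> phi ((a + b) / 2) <= (phi a + phi b) / 2.

Section convexity.
Context {R : realType} (phi : R -> R).
Context (phi_ge0 : forall t, 0 < t -> 0 <= phi t).
Context (phi_decr : forall s t, 0 < s -> s <= t -> phi t <= phi s).
Context (phi_mid : midpoint_convex phi).

Lemma halving_le0 (M x : R) : (forall n, x <= M / 2 ^+ n) -> x <= 0.
Proof.
move=> xM; have [//|x0] := leP x 0.
have : (fun n => M / 2 ^+ n) @ \oo --> (0 : R).
  rewrite (_ : (fun n => _) = geometric M 2^-1); last first.
    by apply/funext => n; rewrite /= exprVn.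
  by apply: cvg_geometric; rewrite ger0_norm ?invr_ge0// invf_lt1 ?ltr1n.
move=> /(cvgr_lt 0) /(_ x x0) [N _ /(_ N (leqnn N)) /=].
by rewrite ltNge xM.
Qed.

(** The excess g of phi over its chord on [a, c] vanishes at a and c.  Each
    point of [a, c] is the midpoint of a point of [a, c] and an endpoint, so
    g <= M on [a, c] improves to g <= M / 2; iterating, g <= 0. *)
Lemma midpoint_chord (a b c : R) : 0 < a -> a <= b -> b <= c ->
  (c - a) * phi b <= (c - b) * phi a + (b - a) * phi c.
Proof.
move=> a0 ab bc; have [ac|ca] := ltP a c; last first.
  have -> : b = a by lra.
  have -> : c = a by lra.
  lra.
pose g x := (c - a) * phi x - ((c - x) * phi a + (x - a) * phi c).
have gmid x y : a <= x -> a <= y -> g ((x + y) / 2) <= (g x + g y) / 2.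
  move=> ax ay; rewrite /g.
  have x0 : 0 < x by lra.
  have y0 : 0 < y by lra.
  have ca0 : 0 <= c - a by lra.
  have := ler_wpM2l ca0 (phi_mid _ _ x0 y0).
  lra.
have ga : g a = 0 by rewrite /g; ring.
have gc : g c = 0 by rewrite /g; ring.
(* An upper bound for g, as phi is nonincreasing and nonnegative. *)
pose M := (c - a) * phi a.
suff gM n x : a <= x <= c -> g x <= M / 2 ^+ n.
  have : g b <= 0 by apply: (@halving_le0 M) => n; apply: gM; rewrite ab bc.
  by rewrite /g; lra.
elim: n x => [|n IH] x /andP[ax xc].
  rewrite expr0 divr1 /g /M.
  have := ler_wpM2l (_ : 0 <= c - a) (phi_decr _ _ a0 ax).
  rewrite subr_ge0 (ltW ac) => /(_ isT).
  have : 0 <= (c - x) * phi a by rewrite mulr_ge0 ?phi_ge0// subr_ge0.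
  have : 0 <= (x - a) * phi c.
    by rewrite mulr_ge0 ?subr_ge0// phi_ge0// (lt_trans a0 ac).
  lra.
have -> : M / 2 ^+ n.+1 = (M / 2 ^+ n) / 2.
  by rewrite exprS invfM [2^-1 * _]mulrC mulrA.
have [xmid|xmid] := leP x ((a + c) / 2).
  have := gmid a (2 * x - a) (lexx _).
  have -> : (a + (2 * x - a)) / 2 = x by field.
  rewrite ga => /(_ ltac:(lra)).
  have := IH (2 * x - a) ltac:(apply/andP; split; lra).
  by lra.
have := gmid c (2 * x - c) (ltW ac).
have -> : (c + (2 * x - c)) / 2 = x by field.
rewrite gc => /(_ ltac:(lra)).
have := IH (2 * x - c) ltac:(apply/andP; split; lra).
by lra.
Qed.

(** The decrease per unit of time is at most that on [s, t], where phi decreases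
    by at most phi s, being nonnegative. *)
Lemma difference_quotient_le s t h : 0 < s -> s < t -> 0 < h ->
  h^-1 * (phi t - phi (t + h)) <= phi s / (t - s).
Proof.
move=> s0 st h0.
have := midpoint_chord s t (t + h) s0 ltac:(lra) ltac:(lra).
have : 0 <= h * phi t by rewrite mulr_ge0 ?phi_ge0//; lra.
move=> h1 h2.
rewrite mulrC ler_pdivrMr// mulrAC ler_pdivlMr ?subr_gt0//.
lra.
Qed.

(** The quotient increases as h decreases to 0, and is bounded above. *)
Lemma difference_quotient_cvg t : 0 < t ->
  cvg (h^-1 * (phi t - phi (t + h)) @[h --> 0^'+]).
Proof.
move=> t0; apply: nonincreasing_at_right_is_cvgr; near=> x.
  move=> h1 h2; rewrite !in_itv/= => /andP[h10 _] /andP[h20 _] h12.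
  have := midpoint_chord t (t + h1) (t + h2) t0 ltac:(lra) ltac:(lra).
  move=> h.
  rewrite ![_^-1 * _]mulrC ler_pdivrMr// mulrAC ler_pdivlMr//.
  lra.
exists (phi (t / 2) / (t - t / 2)) => _ [h /= + <-].
rewrite in_itv/= => /andP[h0 _].
by apply: difference_quotient_le => //; lra.
Unshelve. all: by end_near. Qed.

End convexity.

(** * The inner product of square-integrable functions *)
Section L2_inner.
Context {R : realType} {d} {X : measurableType d} (m : {measure set X -> \bar R}).
Implicit Types f g h : X -> R.

Local Notation L2 := (Lfun m 2%:E).
Local Notation "⟪ f , g ⟫" := (L2_inner m f g).

Lemma Lfun_measurable f : f \in L2 -> measurable_fun setT f.
Proof. by rewrite inE => /andP[]; rewrite inE. Qed.

Lemma Lfun2_linear (a : R) f g : f \in L2 -> g \in L2 ->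
  (fun x => a * f x + g x) \in L2.
Proof.
move=> mf mg; have h1 : (1 <= 2%:E :> \bar R)%E by rewrite lee_fin ler1n.
have [_ /(_ a f g mf mg)] := Lfun_submod_closed m h1.
by [].
Qed.

Lemma Lfun2_mul_integrable f g : f \in L2 -> g \in L2 ->
  m.-integrable setT (EFin \o (fun x => f x * g x)).
Proof. by move=> fL gL; apply/Lfun1_integrable/Lfun2_mul_Lfun1. Qed.

Lemma L2_innerC f g : ⟪ f, g ⟫ = ⟪ g, f ⟫.
Proof. by rewrite /L2_inner; apply: eq_Rintegral => x _; rewrite mulrC. Qed.

Lemma L2_inner_linear (a : R) f g h : f \in L2 -> g \in L2 -> h \in L2 ->
  ⟪ fun x => a * f x + g x, h ⟫ = a * ⟪ f, h ⟫ + ⟪ g, h ⟫.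
Proof.
move=> fL gL hL; rewrite /L2_inner.
rewrite -RintegralZl//; last exact: Lfun2_mul_integrable.
rewrite -RintegralD//.
- by apply: eq_Rintegral => x _; rewrite mulrDl mulrA.
- by have := integrableZl measurableT a (Lfun2_mul_integrable _ _ fL hL).
- exact: Lfun2_mul_integrable.
Qed.

Lemma L2_inner_ge0 f : 0 <= ⟪ f, f ⟫.
Proof. by apply: Rintegral_ge0 => x _; rewrite -expr2 sqr_ge0. Qed.

Lemma L2_inner_ae f g h : f \in L2 -> g \in L2 -> h \in L2 ->
  f = g %[ae m] -> ⟪ f, h ⟫ = ⟪ g, h ⟫.
Proof.
move=> /Lfun_measurable mf /Lfun_measurable mg /Lfun_measurable mh fg.
rewrite /L2_inner /Rintegral; congr fine; apply: ae_eq_integral => //.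
- by apply/measurable_EFinP; exact: measurable_funM.
- by apply/measurable_EFinP; exact: measurable_funM.
- have := ae_eq_mul2r h fg; move=> /(ae_eq_comp EFin). exact.
Qed.

Lemma L2_inner_le_norm f g : f \in L2 -> g \in L2 ->
  ('N[m]_2%:E[EFin \o f] <= 'N[m]_2%:E[EFin \o g])%E ->
  ⟪ f, f ⟫ <= ⟪ g, g ⟫.
Proof.
move=> fL gL fg.
have E h : (\int[m]_x (h x * h x)%:E = 'N[m]_2%:E[EFin \o h] `^ 2)%E.
  rewrite poweR_Lnorm//; apply: eq_integral => x _ /=.
  by rewrite powR_mulrn// -normrX ger0_norm ?expr2// -expr2 sqr_ge0.
rewrite /L2_inner /Rintegral !E fine_le//.
- by rewrite -E; apply: integrable_fin_num => //; exact: Lfun2_mul_integrable.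
- by rewrite -E; apply: integrable_fin_num => //; exact: Lfun2_mul_integrable.
- by rewrite gt0_ler_poweR// in_itv/= leey Lnorm_ge0.
Qed.

End L2_inner.

(** * Symmetric contraction semigroups *)
Section semigroup.
Context {R : realType} {d} {X : measurableType d} (m : {measure set X -> \bar R}).
Context (T : R -> (X -> R) -> (X -> R)).
Context (sgT : L2_semigroup m T).
Implicit Types f g : X -> R.

Local Notation L2 := (Lfun m 2%:E).
Local Notation "⟪ f , g ⟫" := (L2_inner m f g).

Lemma semigroup_inner_add s t f g : 0 < s -> 0 < t -> f \in L2 -> g \in L2 ->
  ⟪ T (s + t) f, g ⟫ = ⟪ T t f, T s g ⟫.
Proof.
move=> s0 t0 fL gL.
have st0 : 0 < s + t by rewrite addr_gt0.
rewrite (@L2_inner_ae _ _ _ m _ (T s (T t f))) ?(sg_L2 sgT)//.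
  by rewrite (sg_symmetric sgT)// (sg_L2 sgT).
exact: (sg_semigroup sgT).
Qed.

Lemma semigroup_innerC t f g : 0 < t -> f \in L2 -> g \in L2 ->
  ⟪ T t f, g ⟫ = ⟪ T t g, f ⟫.
Proof. by move=> t0 fL gL; rewrite (sg_symmetric sgT)// L2_innerC. Qed.

Lemma semigroup_inner_half t f : 0 < t -> f \in L2 ->
  ⟪ T t f, f ⟫ = ⟪ T (t / 2) f, T (t / 2) f ⟫.
Proof.
move=> t0 fL; have t20 : 0 < t / 2 by rewrite divr_gt0.
by rewrite -semigroup_inner_add// -splitr.
Qed.

Lemma semigroup_inner_ge0 t f : 0 < t -> f \in L2 -> 0 <= ⟪ T t f, f ⟫.
Proof. by move=> t0 fL; rewrite semigroup_inner_half// L2_inner_ge0. Qed.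

Lemma semigroup_inner_decr f : f \in L2 ->
  forall s t, 0 < s -> s <= t -> ⟪ T t f, f ⟫ <= ⟪ T s f, f ⟫.
Proof.
move=> fL s t s0; rewrite le_eqVlt => /predU1P[->//|st].
have t0 : 0 < t by exact: lt_trans st.
have s20 : 0 < s / 2 by rewrite divr_gt0.
have ts0 : 0 < (t - s) / 2 by rewrite divr_gt0// subr_gt0.
rewrite (semigroup_inner_half t)// (semigroup_inner_half s)//.
have TsL : T (s / 2) f \in L2 by exact: (sg_L2 sgT).
have TtL : T (t / 2) f \in L2 by apply: (sg_L2 sgT); rewrite // divr_gt0.
have TtsL : T ((t - s) / 2) (T (s / 2) f) \in L2 by exact: (sg_L2 sgT).
have e : T (t / 2) f = T ((t - s) / 2) (T (s / 2) f) %[ae m].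
  have -> : t / 2 = (t - s) / 2 + s / 2 by field.
  exact: (sg_semigroup sgT).
rewrite (L2_inner_ae _ _ _ _ TtL TtsL TtL e) L2_innerC.
rewrite (L2_inner_ae _ _ _ _ TtL TtsL TtsL e).
apply: L2_inner_le_norm => //.
exact: (sg_contraction sgT).
Qed.

(** With u = T_(a/2) f and v = T_(b/2) f, the three terms are the inner product
    of u with v and the squared norms of u and v. *)
Lemma semigroup_inner_midpoint f : f \in L2 ->
  midpoint_convex (fun t => ⟪ T t f, f ⟫).
Proof.
move=> fL a b a0 b0.
have a20 : 0 < a / 2 by rewrite divr_gt0.
have b20 : 0 < b / 2 by rewrite divr_gt0.
have aL : T (a / 2) f \in L2 by exact: (sg_L2 sgT).
have bL : T (b / 2) f \in L2 by exact: (sg_L2 sgT).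
rewrite mulrDl semigroup_inner_add// (semigroup_inner_half a)//.
rewrite (semigroup_inner_half b)//.
have abL := Lfun2_linear m (-1) _ _ aL bL.
have := L2_inner_ge0 m (fun x => -1 * T (a / 2) f x + T (b / 2) f x).
rewrite L2_inner_linear// [⟪ _, fun x => _ ⟫]L2_innerC.
rewrite [⟪ T (b / 2) f, fun x => _ ⟫]L2_innerC.
rewrite !L2_inner_linear// (L2_innerC _ (T (b / 2) f) (T (a / 2) f)).
lra.
Qed.

Lemma semigroup_inner_quadratic (a : R) t f g : 0 < t -> f \in L2 -> g \in L2 ->
  ⟪ T t (fun x => a * f x + g x), fun x => a * f x + g x ⟫ =
  a ^+ 2 * ⟪ T t f, f ⟫ + 2 * a * ⟪ T t f, g ⟫ + ⟪ T t g, g ⟫.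
Proof.
move=> t0 fL gL.
have fgL := Lfun2_linear m a _ _ fL gL.
have TfL : T t f \in L2 by exact: (sg_L2 sgT).
have TgL : T t g \in L2 by exact: (sg_L2 sgT).
have TfgL := Lfun2_linear m a _ _ TfL TgL.
have TL : T t (fun x => a * f x + g x) \in L2 by exact: (sg_L2 sgT).
rewrite (L2_inner_ae _ _ _ _ TL TfgL fgL (sg_linear sgT a t0 fL gL)).
rewrite L2_innerC L2_inner_linear// [⟪ f, _ ⟫]L2_innerC [⟪ g, _ ⟫]L2_innerC.
rewrite !L2_inner_linear// (semigroup_innerC t g f)//.
ring.
Qed.

(** The form of T_t - T_(t+h) is nonnegative, so its value at (f, g) is at most
    half the sum of those at (f, f) and (g, g), as seen by testing with f + g
    and g - f; these are controlled by the slopes of a convex function. *)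
Lemma semigroup_inner_time t h f g : 0 < t -> 0 <= h -> f \in L2 -> g \in L2 ->
  `|⟪ T t f, g ⟫ - ⟪ T (t + h) f, g ⟫| <=
  h / t * (⟪ T (t / 2) f, f ⟫ + ⟪ T (t / 2) g, g ⟫).
Proof.
move=> t0; rewrite le_eqVlt => /predU1P[<-|h0] fL gL.
  by rewrite addr0 subrr normr0 !mul0r.
have th0 : 0 < t + h by rewrite addr_gt0.
have q (k : X -> R) : k \in L2 -> ⟪ T t k, k ⟫ - ⟪ T (t + h) k, k ⟫ <=
    2 * (h / t * ⟪ T (t / 2) k, k ⟫).
  move=> kL.
  have := difference_quotient_le (fun t => ⟪ T t k, k ⟫)
    (fun t t0 => semigroup_inner_ge0 t k t0 kL) (semigroup_inner_decr k kL)
    (semigroup_inner_midpoint k kL) (t / 2) t h.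
  rewrite divr_gt0// gtr_pMr// invf_lt1 ?ltr1n// => /(_ isT isT h0).
  rewrite ler_pdivrMl//; move/le_trans; apply.
  rewrite le_eqVlt; apply/orP; left; apply/eqP.
  field. lra.
have dec (a : R) := semigroup_inner_decr _ (Lfun2_linear m a _ _ fL gL)
  t (t + h) t0 ltac:(lra).
have := dec 1; have := dec (-1); rewrite !semigroup_inner_quadratic//.
have := q f fL; have := q g gL => qg qf d1 d2.
rewrite mulrDr ler_norml; apply/andP; split; lra.
Qed.

End semigroup.

(** * The semigroup of a resistance form *)
Section form.
Context {R : realType} {X : pmetricType R} (E : energy_form R X).
Context (m : {measure set (borel X) -> \bar R}).
Context (T : R -> (borel X -> R) -> (borel X -> R)).
Context (rfE : resistance_form E).
Context (rmE : has_resistance_metric E).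
Context (sgT : semigroup_of_form E m T).

Local Notation L2 := (Lfun m 2%:E).
Local Notation "⟪ f , g ⟫" := (L2_inner m f g).

Lemma sqr_diff_le_energy f x y : fdom E f ->
  `|f x - f y| ^+ 2 <= mdist x y * energy E f f.
Proof.
move=> fE; have := rf1_ge0 rfE fE; rewrite le_eqVlt => /predU1P[/esym e0|e0].
  have [c ->] := (rf1_eq0 rfE fE).1 e0.
  rewrite subrr normr0 expr0n mulr_ge0 ?mdist_ge0// (rf1_ge0 rfE)//.
  exact: (rf1_cst rfE).
rewrite -ler_pdivrMr// -lee_fin -rmE; apply: ereal_sup_ubound; right.
by exists f.
Qed.

Lemma generator_quotientE t h (f u : borel X -> R) : 0 < t -> 0 < h ->
  f \in L2 -> u \in L2 -> T t f = u %[ae m] ->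
  ⟪ u \- T h u, u ⟫ = ⟪ T (t + t) f, f ⟫ - ⟪ T (t + t + h) f, f ⟫.
Proof.
move=> t0 h0 fL uL Tu; have sg := sgf_semigroup sgT.
have TL : T t f \in L2 by exact: (sg_L2 sg).
have ThL : T h u \in L2 by exact: (sg_L2 sg).
have ThTL : T h (T t f) \in L2 by exact: (sg_L2 sg).
have -> : u \- T h u = (fun x => -1 * T h u x + u x).
  by apply/funext => x /=; rewrite mulN1r addrC.
rewrite L2_inner_linear// mulN1r addrC; congr (_ - _).
  rewrite -(L2_inner_ae _ _ _ _ TL uL uL Tu) L2_innerC.
  rewrite -(L2_inner_ae _ _ _ _ TL uL TL Tu).
  by rewrite semigroup_inner_add.
rewrite addrAC semigroup_inner_add ?addr_gt0//.
have e1 : T (t + h) f = T h (T t f) %[ae m].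
  by rewrite addrC; exact: (sg_semigroup sg).
have e2 : T h (T t f) = T h u %[ae m] by exact: (sg_ae sg).
have TthL : T (t + h) f \in L2 by apply: (sg_L2 sg) => //; rewrite addr_gt0.
rewrite [RHS]L2_innerC (L2_inner_ae _ _ _ _ TthL ThTL TL e1).
rewrite (L2_inner_ae _ _ _ _ ThTL ThL TL e2) [RHS]L2_innerC.
by rewrite (L2_inner_ae _ _ _ _ TL uL ThL Tu) L2_innerC.
Qed.

(** For u = T_t f the quotients defining the energy are the difference quotients
    of the convex function K_s(f, f) at s = 2 t, hence converge; their limit is
    at most the slope of the chord on [t, 2 t], where K decreases by at most
    K_t(f, f). *)
Lemma semigroup_finite_energy t (f : borel X -> R) : 0 < t -> f \in L2 ->
  exists u : X -> R, [/\ fdom E u, (u : borel X -> R) \in L2, T t f = u %[ae m] &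
    energy E u u <= ⟪ T t f, f ⟫ / t].
Proof.
move=> t0 fL; have sg := sgf_semigroup sgT.
have TL : T t f \in L2 by exact: (sg_L2 sg).
have quotE (u : borel X -> R) : u \in L2 -> T t f = u %[ae m] ->
  forall h, 0 < h -> h^-1 * (⟪ T (t + t) f, f ⟫ - ⟪ T (t + t + h) f, f ⟫) =
     h^-1 * ⟪ u \- T h u, u ⟫.
  by move=> uL Tu h h0; rewrite (generator_quotientE t h f u).
pose phi := fun t => ⟪ T t f, f ⟫.
have phi0 s : 0 < s -> 0 <= phi s by move=> s0; exact: semigroup_inner_ge0.
have phid := semigroup_inner_decr m T sg f fL.
have phim := semigroup_inner_midpoint m T sg f fL.
have tt0 : 0 < t + t by rewrite addr_gt0.
have [u uD Tu] : exists2 u, dirichlet_domain E m u & T t f = u %[ae m].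
  (* Membership in the domain is the convergence of the quotients. *)
  apply/(sgf_domain sgT) => //.
  have /cvg_ex[l lP] := difference_quotient_cvg phi phi0 phid phim (t + t) tt0.
  apply/cvg_ex; exists l; apply: cvg_trans lP; apply: near_eq_cvg; near=> h.
  by apply: quotE => //; exact: ae_eq_refl.
have [uE uL _] := uD.
exists u; split => //.
apply: (cvgr_to_le (sgf_form sgT uD uD)); near=> h.
rewrite -quotE//.
have := difference_quotient_le phi phi0 phid phim t (t + t) h t0.
by rewrite addrK; apply => //; rewrite ltrDl.
Unshelve. all: by end_near. Qed.
End form.

(** * Averages over balls *)

(** Stated for an abstract measurable type, where the filter instance of the
    almost-everywhere sets is inferred; on Borel sigma-algebras it is not. *)
Lemma ae_imply {R : realType} {d} {X : measurableType d}
    (m : {measure set X -> \bar R}) (P Q : X -> Prop) :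
  (forall z, P z -> Q z) -> {ae m, forall z, P z} -> {ae m, forall z, Q z}.
Proof. exact: filterS. Qed.

(** Even when k is not integrable, it has the same integral as its positive
    part, to which it is almost everywhere equal. *)
Lemma Rintegral_ae_ge0 {R : realType} {d} {X : measurableType d}
    (m : {measure set X -> \bar R}) (k : X -> R) :
  measurable_fun setT k -> {ae m, forall z, 0 <= k z} -> 0 <= \int[m]_z k z.
Proof.
move=> mk k0.
have -> : \int[m]_z k z = \int[m]_z Num.max (k z) 0.
  rewrite /Rintegral; congr fine; apply: ae_eq_integral => //.
  - exact/measurable_EFinP.
  - by apply/measurable_EFinP; exact: measurable_maxr.
  - by apply: filterS k0 => z kz _; rewrite max_l.
by apply: Rintegral_ge0 => z _; rewrite le_max lexx orbT.
Qed.

Section ball_average.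
Context {R : realType} {X : pmetricType R}.
Context (m : {measure set (borel X) -> \bar R}).
Context (bcX : boundedly_compact X).
Context (radon_m : radon m).
Context (supp_m : full_support m).

Local Notation L2 := (Lfun m 2%:E).
Local Notation "⟪ f , g ⟫" := (L2_inner m f g).

Lemma open_ball (x : X) r : open (ball x r).
Proof.
rewrite openE => y; rewrite ballEmdist/= => xy.
rewrite /interior -nbhs_ballE; exists (r - mdist x y).
  by rewrite /= subr_gt0.
move=> z; rewrite !ballEmdist/= => yz.
by rewrite (le_lt_trans (metric_triangle x y z))// addrC -ltrBrDr.
Qed.

Lemma measurable_open (A : set X) : open A -> measurable (A : set (borel X)).
Proof. by move=> oA; exact: sub_sigma_algebra. Qed.

Lemma measurable_ball (x : X) r : measurable (ball x r : set (borel X)).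
Proof. exact: measurable_open (open_ball x r). Qed.

Lemma ball_measure_gt0 x r : 0 < r -> (0 < m (ball x r))%E.
Proof.
by move=> r0; apply: supp_m; [exact: open_ball|exists x; exact: ballxx].
Qed.

Lemma ball_measure_lty x r : (m (ball x r) < +oo)%E.
Proof.
have cK := bcX x r.
apply: le_lt_trans (radon_m _ cK).
apply: le_measure; rewrite ?inE; first exact: measurable_ball.
  rewrite -(setCK (cball x r)); apply: measurableC; apply: measurable_open.
  by apply: closed_openC; apply: compact_closed => //; exact: metric_hausdorff.
by move=> y; rewrite ballEmdist /cball/=; exact: ltW.
Qed.

Lemma fine_ball_measure_gt0 x r : 0 < r -> 0 < fine (m (ball x r)).
Proof. by move=> r0; rewrite fine_gt0// ball_measure_gt0// ball_measure_lty. Qed.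

(** Normalized so that the inner product with it is the average over the ball. *)
Definition ball_avg (x : X) (r : R) : borel X -> R :=
  fun y => (fine (m (ball x r)))^-1 * \1_(ball x r) y.

Lemma integrable_indic_ball x r :
  m.-integrable setT (EFin \o (\1_(ball x r) : borel X -> R)).
Proof.
have mB : measurable (ball x r : set (borel X)) := measurable_ball x r.
apply/integrableP; split; first exact/measurable_EFinP/measurable_indic.
rewrite (eq_integral (fun y : borel X => (\1_(ball x r) y)%:E)).
  by rewrite integral_indic// setIT ball_measure_lty.
by move=> y _; rewrite gee0_abs// lee_fin.
Qed.

Lemma indic_ball_L2 x r : (\1_(ball x r) : borel X -> R) \in L2.
Proof.
have mB : measurable (ball x r : set (borel X)) := measurable_ball x r.
rewrite inE; apply/andP; split; rewrite inE/=; first exact: measurable_indic.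
rewrite /finite_norm unlock /= poweR_lty//.
rewrite (eq_integral (fun y : borel X => (\1_(ball x r) y)%:E)).
  by rewrite integral_indic// setIT ball_measure_lty.
move=> y _; rewrite /= indicE; case: (_ \in _) => /=.
  by rewrite normr1 powR1.
by rewrite normr0 powR0.
Qed.

Lemma ball_avg_L2 x r : ball_avg x r \in L2.
Proof.
have IL := indic_ball_L2 x r.
rewrite (_ : ball_avg x r = fun y => (fine (m (ball x r)))^-1 * \1_(ball x r) y +
    (-1 * \1_(ball x r) y + \1_(ball x r) y)).
  by do 2 apply: Lfun2_linear => //.
by apply/funext => y; rewrite /ball_avg; ring.
Qed.

Lemma inner_indic_ball_avg x r : 0 < r -> ⟪ \1_(ball x r), ball_avg x r ⟫ = 1.
Proof.
move=> r0; have mB : measurable (ball x r : set (borel X)) := measurable_ball x r.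
have -> : ⟪ \1_(ball x r), ball_avg x r ⟫ =
    \int[m]_y ((fine (m (ball x r)))^-1 * \1_(ball x r) y).
  apply: eq_Rintegral => y _; rewrite /ball_avg indicE; case: (_ \in _) => /=.
    by rewrite mul1r.
  by rewrite mul0r mulr0.
rewrite RintegralZl//; last first.
  exact: integrable_indic_ball.
rewrite /Rintegral integral_indic// setIT mulVf// gt_eqF//.
exact: fine_ball_measure_gt0.
Qed.

(** The factor s, used with the values 1 and -1, makes this both an upper and a
    lower bound for the average. *)
Lemma inner_ball_avg_le (s c : R) (h : borel X -> R) x r : 0 < r -> h \in L2 ->
  {ae m, forall z, ball x r z -> s * h z <= c} -> s * ⟪ h, ball_avg x r ⟫ <= c.
Proof.
move=> r0 hL hc; pose I : borel X -> R := \1_(ball x r).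
have IL : I \in L2 by exact: indic_ball_L2.
have bL := ball_avg_L2 x r.
pose k : borel X -> R := fun z => - s * h z + (c * I z + (-1 * I z + I z)).
have OL : (fun z => -1 * I z + I z) \in L2 by exact: Lfun2_linear.
have cIL : (fun z => c * I z + (-1 * I z + I z)) \in L2 by exact: Lfun2_linear.
have kL : k \in L2 by exact: Lfun2_linear.
have := Rintegral_ae_ge0 m (fun z => k z * ball_avg x r z).
rewrite -/(L2_inner m k (ball_avg x r)) /k !L2_inner_linear//.
rewrite inner_indic_ball_avg//.
suff: {ae m, forall z, 0 <= k z * ball_avg x r z}.
  move=> k0 /(_ _ k0); set q := ⟪ _, _ ⟫.
  have: measurable_fun setT (fun z => k z * ball_avg x r z).
    apply: measurable_funM; first exact: (Lfun_measurable m _ kL).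
    exact: (Lfun_measurable m _ bL).
  by move=> mk /(_ mk); lra.
apply: ae_imply hc => z hz; rewrite /k /ball_avg /I indicE.
have [zB|zB] := pselect (ball x r z); last by rewrite (memNset zB) !mulr0.
rewrite (mem_set zB) mulr1 mulr_ge0// ?invr_ge0 ?fine_ge0//.
by have := hz zB; lra.
Qed.

End ball_average.

(** * Estimates for the transition density *)
Section kernel.
Context {R : realType} {X : pmetricType R} (E : energy_form R X).
Context (m : {measure set (borel X) -> \bar R}).
Context (T : R -> (borel X -> R) -> (borel X -> R)).
Context (Y : hunt_process X) (p : R -> X -> X -> R).
Context (bcX : boundedly_compact X).
Context (rfE : resistance_form E).
Context (rmE : has_resistance_metric E).
Context (radon_m : radon m).
Context (supp_m : full_support m).
Context (sgT : semigroup_of_form E m T).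
Context (YT : forall (t : R) (f : borel X -> R),
  0 < t -> f \in Lfun m 2%:E ->
  (exists C : R, forall x, `|f x| <= C) ->
  (fun x : borel X => \int[hp_law Y (Some x)]_w oapp f 0 (hp_path t w))
    = T t f %[ae m]).
Context (pY : transition_density m Y p).
Context (cont_p : jointly_continuous p).

Local Notation L2 := (Lfun m 2%:E).
Local Notation "⟪ f , g ⟫" := (L2_inner m f g).
Local Notation avg := (ball_avg m).

Definition visit (t : R) (A : set X) : set (hp_Omega Y) :=
  [set w | exists2 y, A y & hp_path t w = Some y].

(** The image of a ball is open in the one-point compactification, hence in its
    Borel sigma-algebra. *)
Lemma measurable_visit_ball t x r : 0 <= t -> measurable (visit t (ball x r)).
Proof.
move=> t0; have [_ + ] := @hp_filtration_sigma _ _ Y t t0; apply.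
have -> : visit t (ball x r) = hp_path t @^-1` (Some @` ball x r).
  apply/seteqP; split => w /=; first by move=> [y yB e]; exists y.
  by move=> [y yB e]; exists y.
apply: hp_adapted => //; apply: sub_sigma_algebra.
by apply: one_point_compactification_open_some; exact: open_ball.
Qed.

Lemma integral_density_ball t z x r : 0 < t ->
  (\int[m]_(y in ball x r) (p t z y)%:E =
   hp_law Y (Some z) (visit t (ball x r)))%E.
Proof.
by move=> t0; have [_ [_ law]] := pY t t0; rewrite law//; exact: measurable_ball.
Qed.

Lemma integrable_density_ball t z x r : 0 < t ->
  m.-integrable (ball x r) (EFin \o (p t z : borel X -> R)).
Proof.
move=> t0; have [p0 [mp _]] := pY t t0.
apply/integrableP; split.
  by apply/measurable_EFinP; apply: measurable_funS (mp z).
rewrite (eq_integral (fun y : borel X => (p t z y)%:E)); last first.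
  by move=> y _ /=; rewrite ger0_norm.
rewrite integral_density_ball// (le_lt_trans _ (ltry 1))// probability_le1//.
exact: measurable_visit_ball (ltW t0).
Qed.

Lemma ball_avg_bounded x r : exists C : R, forall y, `|avg x r y| <= C.
Proof.
exists `|(fine (m (ball x r)))^-1| => y; rewrite /ball_avg normrM indicE.
by case: (_ \in _); rewrite ?normr1 ?normr0 ?mulr1 ?mulr0.
Qed.

Lemma semigroup_avg t x r : 0 < t ->
  (fun z : borel X => (fine (m (ball x r)))^-1 *
     \int[m]_(y in (ball x r : set (borel X))) p t z y) = T t (avg x r) %[ae m].
Proof.
move=> t0.
have aL := ball_avg_L2 m bcX radon_m x r.
apply: ae_imply (YT t _ t0 aL (ball_avg_bounded x r)) => z /(_ Logic.I) <- _.
have mV := measurable_visit_ball t x r (ltW t0).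
rewrite {1}/Rintegral integral_density_ball//.
transitivity (\int[hp_law Y (Some z)]_w
   ((fine (m (ball x r)))^-1 * \1_(visit t (ball x r)) w)); last first.
  apply: eq_Rintegral => w _.
  have [[y yB pw]|nV] := pselect (visit t (ball x r) w).
    rewrite [in LHS]indicE mem_set; last by exists y.
    by rewrite pw /= /ball_avg indicE mem_set.
  rewrite [in LHS]indicE (memNset nV) mulr0.
  case pw : (hp_path t w) => [y|//] /=.
  by rewrite /ball_avg indicE memNset ?mulr0// => yB; apply: nV; exists y.
rewrite RintegralZl//; last exact: integrable_indic.
by rewrite /Rintegral integral_indic// setIT.
Qed.

Lemma density_near t x y e : 0 < t -> 0 < e -> exists2 d0 : R, 0 < d0 &
  forall x' y', ball x d0 x' -> ball y d0 y' -> `|p t x y - p t x' y'| <= e.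
Proof.
move=> t0 e0; have /cvgrPdist_le/(_ e e0) := cont_p t x y t0.
rewrite -nbhs_ballE => -[d0 d0_gt0 sub]; exists d0 => // x' y' xx' yy'.
by apply: (sub (t, x', y')); split => //; split => //; exact: ballxx.
Qed.

Lemma ball_mean_bounds (f : borel X -> R) x r c e : 0 < r ->
  m.-integrable (ball x r) (EFin \o f) ->
  (forall y, ball x r y -> `|c - f y| <= e) ->
  `|c - (fine (m (ball x r)))^-1 *
       \int[m]_(y in (ball x r : set (borel X))) f y| <= e.
Proof.
move=> r0 fi fe.
have mB : measurable (ball x r : set (borel X)) := measurable_ball x r.
have a0 := fine_ball_measure_gt0 m bcX radon_m supp_m x r r0.
have ci (k : R) : m.-integrable (ball x r : set (borel X)) (EFin \o cst k).
  apply/integrableP; split; first exact/measurable_EFinP.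
  rewrite (eq_integral (cst `|k|%:E))// integral_cst// lte_mul_pinfty//.
  exact: ball_measure_lty.
have h1 : (c - e) * fine (m (ball x r)) <=
    \int[m]_(y in (ball x r : set (borel X))) f y.
  rewrite -Rintegral_cst//; apply: (le_Rintegral mB (ci (c - e)) fi) => y /fe.
  by rewrite ler_norml /= => /andP[]; lra.
have h2 : \int[m]_(y in (ball x r : set (borel X))) f y <=
    (c + e) * fine (m (ball x r)).
  rewrite -Rintegral_cst//; apply: (le_Rintegral mB fi (ci (c + e))) => y /fe.
  by rewrite ler_norml /= => /andP[]; lra.
rewrite ler_distl mulrC; apply/andP; split.
  by rewrite lerBlDr ler_pdivrMr//; lra.
by rewrite -lerBlDr ler_pdivlMr//; lra.
Qed.

(** For almost every z near y the value of T_t (avg x d) at z is the average of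
    p t z over the ball around x, which is close to p t y x. *)
Lemma semigroup_avg_cvg t x y : 0 < t ->
  ⟪ T t (avg x d), avg y d ⟫ @[d --> 0^'+] --> p t y x.
Proof.
move=> t0; apply/cvgrPdist_le => e e0.
have [d0 d0_gt0 pd] := density_near t y x e t0 e0.
near=> d.
have d_gt0 : 0 < d by [].
have dd0 : d <= d0 by near: d; exact: nbhs_right_le.
have TL : T t (avg x d) \in L2.
  by apply: (sg_L2 (sgf_semigroup sgT)) => //; exact: ball_avg_L2.
have TE : {ae m, forall z, ball y d z -> `|p t y x - T t (avg x d) z| <= e}.
  apply: ae_imply (semigroup_avg t x d t0) => z /(_ Logic.I) <- yz.
  apply: ball_mean_bounds => //; first exact: integrable_density_ball.
  move=> x' xx'; apply: pd; apply: le_ball; [exact: dd0| |exact: dd0|] => //.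
rewrite ler_norml; apply/andP; split.
  have := inner_ball_avg_le m bcX radon_m supp_m 1 (p t y x + e) _ y d d_gt0 TL.
  rewrite mul1r => h; have := h _; rewrite lerNl opprB lerBlDl; apply.
  apply: ae_imply TE => z + yz => /(_ yz); rewrite ler_norml mul1r => /andP[]; lra.
have := inner_ball_avg_le m bcX radon_m supp_m (-1) (e - p t y x) _ y d d_gt0 TL.
rewrite mulN1r => h; have := h _; rewrite lerBrDl; apply.
apply: ae_imply TE => z + yz => /(_ yz); rewrite ler_norml mulN1r => /andP[]; lra.
Unshelve. all: by end_near. Qed.

Lemma density_ge0 t x y : 0 < t -> 0 <= p t x y.
Proof. by move=> t0; have [+ _] := pY t t0. Qed.

Lemma density_sym t x y : 0 < t -> p t x y = p t y x.
Proof.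
move=> t0; have c1 := semigroup_avg_cvg t x y t0.
apply: (cvg_unique _ _ c1) => //=.
have : ⟪ T t (avg y d), avg x d ⟫ @[d --> 0^'+] --> p t x y.
  exact: semigroup_avg_cvg.
rewrite (_ : (fun d => ⟪ T t (avg y d), avg x d ⟫) =
  (fun d => ⟪ T t (avg x d), avg y d ⟫))//.
apply/funext => d; apply: (semigroup_innerC m T (sgf_semigroup sgT)) => //;
  exact: ball_avg_L2.
Qed.

Lemma density_time t h x y : 0 < t -> 0 <= h ->
  `|p t x y - p (t + h) x y| <= h / t * (p (t / 2) x x + p (t / 2) y y).
Proof.
move=> t0 h0; have th0 : 0 < t + h by rewrite ltr_wpDr.
have t20 : 0 < t / 2 by rewrite divr_gt0.
have cl : `|⟪ T t (avg y d), avg x d ⟫ - ⟪ T (t + h) (avg y d), avg x d ⟫|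
    @[d --> 0^'+] --> `|p t x y - p (t + h) x y|.
  by apply: cvg_norm; apply: cvgB; exact: semigroup_avg_cvg.
have cr : h / t * (⟪ T (t / 2) (avg x d), avg x d ⟫ +
      ⟪ T (t / 2) (avg y d), avg y d ⟫) @[d --> 0^'+] -->
    h / t * (p (t / 2) x x + p (t / 2) y y).
  apply: cvgM; first exact: cvg_cst.
  by apply: cvgD; exact: semigroup_avg_cvg.
apply: (ler_cvg_to cl cr); near=> d => /=.
rewrite [X in _ <= _ * X]addrC.
apply: (semigroup_inner_time m T (sgf_semigroup sgT)) => //; exact: ball_avg_L2.
Unshelve. all: by end_near. Qed.

(** The limit, as d tends to 0, of an estimate for u = T_t (avg x d), whose
    energy is at most K_t(avg x d, avg x d) / t: two averages of u over the
    balls of radius d around z and w differ by at most the largest difference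
    of values of u there. *)
Lemma density_space t x z w : 0 < t ->
  `|p t z x - p t w x| ^+ 2 <= mdist z w * (p t x x / t).
Proof.
move=> t0.
have cl : `|⟪ T t (avg x d), avg z d ⟫ - ⟪ T t (avg x d), avg w d ⟫| ^+ 2
    @[d --> 0^'+] --> `|p t z x - p t w x| ^+ 2.
  rewrite expr2; under eq_fun do rewrite expr2.
  by apply: cvgM; apply: cvg_norm; apply: cvgB; exact: semigroup_avg_cvg.
have cr : (mdist z w + (d + d)) * (⟪ T t (avg x d), avg x d ⟫ / t)
    @[d --> 0^'+] --> mdist z w * (p t x x / t).
  apply: cvgM; last by apply: cvgM; [exact: semigroup_avg_cvg|exact: cvg_cst].
  have c0 : d @[d --> (0 : R)^'+] --> (0 : R).
    by apply: (@cvg_at_right_filter _ _ (fun d => d)); exact: cvg_id.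
  rewrite -[X in _ --> X]addr0; apply: cvgD; first exact: cvg_cst.
  by rewrite -[X in _ --> X](addr0 (0 : R)); exact: cvgD.
apply: (ler_cvg_to cl cr); near=> d => /=.
have d0 : 0 < d by [].
have bL v : avg v d \in L2 by exact: ball_avg_L2.
have TL : T t (avg x d) \in L2 by exact: (sg_L2 (sgf_semigroup sgT)).
have [u [uE uL Tu uen]] := semigroup_finite_energy E m T sgT t _ t0 (bL x).
rewrite !(L2_inner_ae _ _ _ _ TL uL (bL _) Tu).
set e := ⟪ T t (avg x d), avg x d ⟫ in uen *.
rewrite -[⟪ u, avg x d ⟫](L2_inner_ae _ _ _ _ TL uL (bL x) Tu) -/e.
(* V bounds the square of the oscillation of u between the two balls. *)
set V := _ * (e / t).
have V0 : 0 <= V.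
  rewrite mulr_ge0 ?addr_ge0 ?mdist_ge0 ?(ltW d0)//.
  by rewrite (le_trans _ uen)// (rf1_ge0 rfE).
have uV z' w' : ball z d z' -> ball w d w' -> `|u z' - u w'| <= Num.sqrt V.
  rewrite !ballEmdist /= => zz' ww'.
  rewrite -sqrtr_sqr ler_wsqrtr//.
  have := sqr_diff_le_energy E rfE rmE u z' w' uE.
  rewrite real_normK ?num_real// => /le_trans; apply.
  apply: ler_pM => //; rewrite ?mdist_ge0 ?(rf1_ge0 rfE)//.
  have := metric_triangle z' z w'; have := metric_triangle z w w'.
  by rewrite (metric_sym z' z); lra.
rewrite -(sqr_sqrtr V0) lerXn2r ?nnegrE ?sqrtr_ge0//.
have le_avg s c (v : X) := inner_ball_avg_le m bcX radon_m supp_m s c u v d d0 uL.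
have step s : s = 1 \/ s = -1 ->
    s * (⟪ u, avg z d ⟫ - ⟪ u, avg w d ⟫) <= Num.sqrt V.
  move=> s1.
  suff: - s * ⟪ u, avg w d ⟫ <= Num.sqrt V - s * ⟪ u, avg z d ⟫ by lra.
  apply: (le_avg _ _ _); apply: aeW => w' ww'.
  suff: s * ⟪ u, avg z d ⟫ <= Num.sqrt V + s * u w' by lra.
  apply: (le_avg _ _ _); apply: aeW => z' zz'.
  have := uV z' w' zz' ww'; rewrite ler_norml => /andP[].
  by case: s1 => ->; lra.
have := step 1 (or_introl erefl); have := step (-1) (or_intror erefl).
by rewrite ler_norml => s1 s2; apply/andP; split; lra.
Unshelve. all: by end_near. Qed.

Lemma mdist_cball r x y : cball (point : X) r x -> cball (point : X) r y ->
  mdist x y <= 2 * r.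
Proof.
rewrite /cball /= => xr yr; have := metric_triangle x point y.
by rewrite (metric_sym x point); lra.
Qed.

(** The average of p t x over the ball around the root is at most 1 / c, so that
    b = p t x y <= 2 / c for some y in the ball; then a = p t x x satisfies
    (a - b)^2 <= (2 r / t) a, which forces a <= 2 b + 2 r / t. *)
Lemma density_diag_le t r c x : 0 < t -> 0 < r -> 0 < c ->
  (c%:E <= m (ball (point : X) r))%E -> cball point r x ->
  p t x x <= 4 / c + 2 * r / t.
Proof.
move=> t0 r0 c0 cm xr.
have [y yr py] : exists2 y, ball point r y & p t x y <= 2 / c.
  apply: contrapT => no.
  have : (1 < (2 / c)%:E * m (ball (point : X) r))%E.
    apply: (@lt_le_trans _ _ ((2 / c)%:E * c%:E)%E).
      by rewrite -EFinM lte_fin divfK ?gt_eqF// ltr1n.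
    by apply: lee_wpmul2l => //; rewrite lee_fin divr_ge0// ltW.
  rewrite ltNge => /negP; apply.
  rewrite -integral_cst; last exact: measurable_ball.
  apply: (@le_trans _ _ (\int[m]_(y in ball (point : X) r) (p t x y)%:E)%E).
    have [p0 [mp _]] := pY t t0.
    apply: ge0_le_integral => //.
    - exact: measurable_ball.
    - by move=> y _; rewrite lee_fin divr_ge0// ltW.
    - by apply/measurable_EFinP; apply: measurable_funS (mp x).
    - move=> y yr; rewrite lee_fin leNgt; apply/negP => pl; apply: no.
      by exists y => //; exact: ltW.
  rewrite integral_density_ball// probability_le1//.
  exact: measurable_visit_ball (ltW t0).
have yc : cball point r y by move: yr; rewrite ballEmdist /cball /=; exact: ltW.
have := density_space t x x y t0; rewrite real_normK ?num_real//.
rewrite (density_sym t y x t0).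
have := mdist_cball r x y xr yc.
have a0 := density_ge0 t x x t0; have b0 := density_ge0 t x y t0.
have at0 : 0 <= p t x x / t by rewrite divr_ge0// ltW.
move=> /(ler_wpM2r at0) h1 /le_trans /(_ h1).
(* Bring the estimate to the form (a - b)^2 <= q a with q = 2 r / t. *)
have -> : 2 * r * (p t x x / t) = (2 * r / t) * p t x x by ring.
have : 0 < 2 * r / t by rewrite divr_gt0// mulr_gt0.
have -> : 4 / c = 2 * (2 / c) by ring.
move: (p t x x) (p t x y) (2 * r / t) (2 / c) a0 b0 py => a b q k a0 b0 bk q0 ab.
rewrite leNgt; apply/negP => ka.
have : (a + q) / 2 < a - b by lra.
nra.
Qed.

Lemma density_le t t0 r c x y : 0 < t0 -> t0 <= t -> 0 < r -> 0 < c ->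
  (c%:E <= m (ball (point : X) r))%E -> cball point r x -> cball point r y ->
  p t x y <= 2 * (4 / c + 2 * r / t0) + 2 * r / t0.
Proof.
move=> t00 tt r0 c0 cm xr yr; have t_gt0 : 0 < t by exact: lt_le_trans tt.
have rt : 2 * r / t <= 2 * r / t0.
  by rewrite ler_wpM2l ?lef_pV2 ?posrE// mulr_ge0// ltW.
have := density_diag_le t r c y t_gt0 r0 c0 cm yr.
have := density_space t y x y t_gt0; rewrite real_normK ?num_real//.
have := mdist_cball r x y xr yr.
have a0 := density_ge0 t y y t_gt0; have b0 := density_ge0 t x y t_gt0.
have at0 : 0 <= p t y y / t by rewrite divr_ge0// ltW.
move=> /(ler_wpM2r at0) h1 /le_trans /(_ h1).
(* Again (a - b)^2 <= q a, now used as b <= a + (a + q) / 2. *)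
have -> : 2 * r * (p t y y / t) = (2 * r / t) * p t y y by ring.
have : 0 < 2 * r / t by rewrite divr_gt0// mulr_gt0.
have : 0 <= 4 / c by rewrite divr_ge0// ltW.
move: (p t y y) (p t x y) (2 * r / t) (2 * r / t0) (4 / c) a0 b0 rt
  => a b q q' k a0 b0 qq k0 q0 ab ak.
have : b <= a + (a + q) / 2; last by lra.
rewrite leNgt; apply/negP => ka.
have h1' : 0 < (b - a) - (a + q) / 2 by lra.
have h2' : 0 < (b - a) + (a + q) / 2 by lra.
have := mulr_gt0 h1' h2'; have := sqr_ge0 (a - q).
move: ab; rewrite !expr2; lra.
Qed.

Lemma density_space_le t t0 K x z w d : 0 < t0 -> t0 <= t ->
  p t x x <= K -> mdist z w <= d -> `|p t z x - p t w x| <= Num.sqrt (d * (K / t0)).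
Proof.
move=> t00 tt pK zw; have t_gt0 : 0 < t by exact: lt_le_trans tt.
have p0 := density_ge0 t x x t_gt0.
rewrite -sqrtr_sqr ler_wsqrtr//.
have := density_space t x z w t_gt0; rewrite real_normK ?num_real//.
move=> /le_trans; apply.
apply: ler_pM => //; rewrite ?mdist_ge0 ?divr_ge0 ?(ltW t_gt0)//.
by apply: ler_pM; rewrite // ?invr_ge0 ?(ltW t_gt0)// lef_pV2 ?posrE.
Qed.

(** Move x, then y, then t.  The last step involves the density at the time
    t / 2, whose on-diagonal bound has 4 r / t0 in place of 2 r / t0. *)
Lemma density_osc_le t t' t0 r c x y x' y' d : 0 < t0 -> t0 <= t -> t0 <= t' ->
  0 < r -> 0 < c -> (c%:E <= m (ball (point : X) r))%E ->
  cball point r x -> cball point r y -> cball point r x' -> cball point r y' ->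
  `|t - t'| <= d -> mdist x x' <= d -> mdist y y' <= d ->
  `|p t x y - p t' x' y'| <=
  2 * Num.sqrt (d * ((4 / c + 2 * r / t0) / t0)) +
  d * (2 * (4 / c + 4 * r / t0) / t0).
Proof.
move=> t00.
wlog tt' : t t' x y x' y' / t <= t'.
  move=> wl tt0 tt0'; have [tt'|t't] := leP t t'; first exact: wl.
  move=> r0 c0 cm xr yr xr' yr'.
  rewrite distrC metric_sym (metric_sym y) (distrC (p t x y)).
  by apply: wl => //; exact: ltW.
move=> tt0 tt0' r0 c0 cm xr yr xr' yr' td xd yd.
have t_gt0 : 0 < t by exact: lt_le_trans tt0.
have rt : 2 * r / t <= 2 * r / t0.
  by rewrite ler_wpM2l ?lef_pV2 ?posrE// mulr_ge0// ltW.
have K z : cball point r z -> p t z z <= 4 / c + 2 * r / t0.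
  by move=> zr; have := density_diag_le t r c z t_gt0 r0 c0 cm zr; lra.
have K2 z : cball point r z -> p (t / 2) z z <= 4 / c + 4 * r / t0.
  move=> zr; have t20 : 0 < t / 2 by rewrite divr_gt0.
  have := density_diag_le (t / 2) r c z t20 r0 c0 cm zr.
  rewrite invf_div mulrCA mulrA.
  move: rt.
  by rewrite -[2 * r / t]mulrA -[2 * r / t0]mulrA -[4 * r / t0]mulrA; lra.
have h1 := density_space_le t t0 _ y x x' d t00 tt0 (K y yr) xd.
have h2 := density_space_le t t0 _ x' y y' d t00 tt0 (K x' xr') yd.
rewrite (density_sym t y x' t_gt0) (density_sym t y' x' t_gt0) in h2.
have h3 : `|p t x' y' - p t' x' y'| <= d * (2 * (4 / c + 4 * r / t0) / t0).
  have tt'0 : 0 <= t' - t by rewrite subr_ge0.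
  have := density_time t (t' - t) x' y' t_gt0 tt'0.
  rewrite (addrC t) subrK => /le_trans; apply.
  have t20 : 0 < t / 2 by rewrite divr_gt0.
  have -> : d * (2 * (4 / c + 4 * r / t0) / t0) =
    (d / t0) * (2 * (4 / c + 4 * r / t0)) by ring.
  apply: ler_pM.
  - by rewrite divr_ge0// ltW.
  - by rewrite addr_ge0// density_ge0.
  - apply: ler_pM => //; rewrite ?invr_ge0 ?(ltW t_gt0)//.
      by move: td; rewrite distrC ger0_norm.
    by rewrite lef_pV2 ?posrE.
  - by have := K2 x' xr'; have := K2 y' yr'; lra.
have -> : p t x y - p t' x' y' = (p t x y - p t x' y) +
  ((p t x' y - p t x' y') + (p t x' y' - p t' x' y')) by ring.
apply: le_trans (ler_normD _ _) _.
apply: le_trans (lerD h1 (ler_normD _ _)) _.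
lra.
Qed.
End kernel.

(** * Masses of balls under local Gromov-Hausdorff-vague convergence *)
Section lower_integral.
Import HBNNSimple.

(** The integral of a nonnegative function is the supremum of the integrals of
    the simple functions below it, measurable or not.  This matters because the
    Prohorov distance of two restrictions need not depend measurably on the
    radius. *)
Lemma integral_ge_cst {R : realType} {d} {X : measurableType d}
    (m : {measure set X -> \bar R}) (f : X -> \bar R) (k : R) (A D : set X) :
  0 <= k -> measurable A -> A `<=` D ->
  (forall s, D s -> (0 <= f s)%E) -> (forall s, A s -> (k%:E <= f s)%E) ->
  (k%:E * m A <= \int[m]_(s in D) f s)%E.
Proof.
move=> k0 mA AD f0 fk.
rewrite ge0_integralE//.
pose h := scale_nnsfun (indic_nnsfun R mA) k0.
apply: ereal_sup_ubound; exists h => /=.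
  move=> s; rewrite -[X in (X%:E <= _)%E]/(k * \1_A s).
  rewrite patchE indicE; case: ifPn => [/set_mem Ds|nDs].
    have [As|nAs] := pselect (A s); first by rewrite (mem_set As) mulr1 fk.
    by rewrite (memNset nAs) mulr0 f0.
  rewrite memNset ?mulr0// => As; move/negP: nDs; apply.
  by apply: mem_set; exact: AD.
rewrite (sintegralrM m k (indic_nnsfun R mA)) -integralT_nnsfun.
by congr (_ * _)%E; rewrite /= integral_indic// setIT.
Qed.

End lower_integral.

Section vague.
Context {R : realType}.

Lemma prohorov_dist_ge0 (M : pmetricType R) (mu nu : set (borel M) -> \bar R) :
  (0 <= prohorov_dist mu nu)%E.
Proof. by apply: le_ereal_inf_tmp => _ [e [e0 _] <-]; rewrite lee_fin ltW. Qed.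

(** Otherwise the integrand would be at least exp(- b) eta on [a, b]. *)
Lemma vague_dist_lt (M : pmetricType R) (mu nu : set (borel M) -> \bar R)
    (a b eta : R) : 0 < a -> a < b -> 0 <= eta -> eta <= 1 ->
  (vague_dist mu nu < (expR (- b) * eta * (b - a))%:E)%E ->
  exists2 s, a <= s <= b &
    (prohorov_dist (restrict_measure s mu) (restrict_measure s nu) < eta%:E)%E.
Proof.
move=> a0 ab eta0 eta1; apply: contraPP => no; apply/negP; rewrite -leNgt.
have mab : lebesgue_measure (`[a, b]%classic : set R) = (b - a)%:E.
  by rewrite lebesgue_measure_itv/= lte_fin ab -EFinD.
rewrite EFinM -mab; apply: integral_ge_cst.
- by rewrite mulr_ge0// expR_ge0.
- exact: measurable_itv.
- by move=> s /=; rewrite !in_itv/= andbT => /andP[/(lt_le_trans a0)].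
- move=> s _; rewrite mule_ge0 ?lee_fin ?expR_ge0// le_min lee_fin ler01.
  exact: prohorov_dist_ge0.
- move=> s /=; rewrite in_itv/= => sab.
  rewrite EFinM lee_pmul ?lee_fin ?expR_ge0//.
    by rewrite ler_expR lerN2; case/andP: sab.
  rewrite le_min lee_fin eta1 leNgt; apply/negP => lt; apply: no.
  by exists s.
Qed.

Lemma open_thicken (M : metricType R) (A : set M) e : open (thicken A e).
Proof.
rewrite openE => x [y Ay xy].
rewrite /interior -nbhs_ballE; exists (e - mdist x y).
  by rewrite /= subr_gt0.
move=> z; rewrite ballEmdist/= => xz; exists y => //.
have := metric_triangle z x y; rewrite (metric_sym z x); lra.
Qed.

Lemma isometry_continuous (S M : pmetricType R) (f : S -> M) :
  rooted_isometric f -> continuous f.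
Proof.
move=> [_ fd] x; apply/metricType_numDomainType.cvgrPdist_lt => e e0.
apply/nbhs_ballP; exists e => // y.
by rewrite ballEmdist/= fd.
Qed.

Lemma preimage_isometry_ball (S M : pmetricType R) (f : S -> M) r :
  rooted_isometric f -> f @^-1` ball point r = ball point r.
Proof.
move=> [fp fd]; apply/seteqP; split => x;
  by rewrite /preimage !ballEmdist/= -[in mdist point (f x)]fp fd.
Qed.

Lemma closure_ball_subset (M : pmetricType R) (x : M) s r : s < r ->
  closure (ball x s) `<=` ball x r.
Proof.
move=> sr y /(_ (ball y (r - s))) [|z []].
  by apply: nbhsx_ballx; rewrite subr_gt0.
rewrite !ballEmdist/= => xz yz; have := metric_triangle x z y.
by rewrite (metric_sym z y); lra.
Qed.

(** At a radius s in [r/4, r/2] where the restrictions to the closed balls of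
    radius s are Prohorov-close, apply the Prohorov estimate to the ball of
    radius r/4: its enlargement stays, after restriction, in the ball of
    radius r. *)
Lemma ghv_dist_ball_ge (S T : pmetricType R)
    (muS : {measure set (borel S) -> \bar R})
    (muT : {measure set (borel T) -> \bar R}) (r eta : R) :
  0 < r -> 0 <= eta -> eta <= 1 ->
  (ghv_dist muS muT < (expR (- (r / 2)) * eta * (r / 4))%:E)%E ->
  (muT (ball (point : T) (r / 4)%R) <= muS (ball (point : S) r) + eta%:E)%E.
Proof.
move=> r0 eta0 eta1 /ereal_inf_lt[_ [M [f [g [bcM isf isg ->]]]]].
rewrite gt_max => /andP[_].
have -> : r / 4 = r / 2 - r / 4 by field.
move=> /vague_dist_lt[]//; [lra|lra|] => s /andP[rs sr].
move=> /ereal_inf_lt[_ [e [e0 He] <-]]; rewrite lte_fin => ee.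
have mb := measurable_ball (point : M) (r / 4).
have [_] := He _ mb.
rewrite /restrict_measure /pushforward.
have -> : ball (point : M) (r / 4) `&` closure (ball point s) = ball point (r / 4).
  rewrite setIidl// => y yr; apply: subset_closure; move: yr.
  by rewrite !ballEmdist/= => /lt_le_trans; apply.
rewrite preimage_isometry_ball//.
have -> : r / 2 - r / 4 = r / 4 by field.
move=> /le_trans; apply; apply: leeD; last by rewrite lee_fin ltW.
have cf := isometry_continuous _ _ f isf.
apply: le_measure; rewrite ?inE.
- rewrite preimage_setI; apply: measurableI.
    apply: measurable_open; apply: open_comp; first by move=> x _; exact: cf.
    exact: open_thicken.
  rewrite -[X in measurable X]setCK; apply: measurableC; apply: measurable_open.
  rewrite preimage_setC; apply: open_comp; first by move=> x _; exact: cf.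
  by apply: closed_openC; exact: closed_closure.
- exact: measurable_ball.
- move=> x [_ /=] xs; rewrite -(preimage_isometry_ball _ _ f)//.
  by apply: closure_ball_subset xs; lra.
Qed.

Lemma eventually_lower_bound (a : nat -> \bar R) (c : R) : 0 < c ->
  (forall n, 0 < a n)%E -> (\forall n \near \oo, c%:E <= a n)%E ->
  exists2 c' : R, 0 < c' & forall n, (c'%:E <= a n)%E.
Proof.
move=> c0 a0 [N _ aN].
suff [c' c'0 ac'] : exists2 c' : R, 0 < c' &
    forall n, (n < N)%N -> (c'%:E <= a n)%E.
  exists (Num.min c c'); first by rewrite lt_min c0.
  move=> n; have [nN|Nn] := ltnP n N.
    by apply: le_trans (ac' n nN); rewrite lee_fin ge_min lexx orbT.
  by apply: le_trans (aN n Nn); rewrite lee_fin ge_min lexx.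
elim: N {aN} => [|N [c' c'0 ac']]; first by exists 1.
have [b b0 ab] : exists2 b : R, 0 < b & (b%:E <= a N)%E.
  have := a0 N; case: (a N) => [b| |]// b0; first by exists b.
  by exists 1 => //; rewrite leey.
exists (Num.min b c'); first by rewrite lt_min b0.
move=> n; rewrite ltnS leq_eqVlt => /predU1P[->|nN].
  by apply: le_trans ab; rewrite lee_fin ge_min lexx.
by apply: le_trans (ac' n nN); rewrite lee_fin ge_min lexx orbT.
Qed.

Lemma ghv_cvg_ball_lower_bound (F_ : nat -> pmetricType R) (F : pmetricType R)
    (mu_ : forall n, {measure set (borel (F_ n)) -> \bar R})
    (mu : {measure set (borel F) -> \bar R}) (r : R) :
  (forall n, full_support (mu_ n)) -> full_support mu -> 0 < r ->
  ghv_dist (mu_ n) mu @[n --> \oo] --> 0%E ->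
  exists2 c : R, 0 < c & forall n, (c%:E <= mu_ n (ball (point : F_ n) r))%E.
Proof.
move=> supp_ supp r0 ghv.
have r40 : 0 < r / 4 by rewrite divr_gt0.
(* Of a mass of at least 2 eta in the limit, eta is lost in the Prohorov
   estimate. *)
have [eta eta0 [eta1 etam]] : exists2 eta : R, 0 < eta &
    eta <= 1 /\ ((eta + eta)%:E <= mu (ball (point : F) (r / 4)%R))%E.
  have := ball_measure_gt0 mu supp point (r / 4) r40.
  case: (mu _) => [b| |]//; last by exists 1 => //; split => //; rewrite leey.
  rewrite lte_fin => b0; exists (Num.min 1 (b / 2)).
    by rewrite lt_min ltr01 divr_gt0.
  split; first by rewrite ge_min lexx.
  have : Num.min 1 (b / 2) <= b / 2 by rewrite ge_min lexx orbT.
  by rewrite lee_fin; lra.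
apply: (eventually_lower_bound _ eta eta0).
  by move=> n; exact: ball_measure_gt0.
have e0 : (0 < (expR (- (r / 2)) * eta * (r / 4))%:E)%E.
  by rewrite lte_fin !mulr_gt0// expR_gt0.
have [N _ HN] := ghv _ (open_ereal_lt' e0).
exists N => // n /HN /= /(ghv_dist_ball_ge _ _ _ _ _ _ r0 (ltW eta0) eta1) h.
have := le_trans etam h; rewrite EFinD.
by rewrite leeD2rE.
Qed.
End vague.

(** * Uniform boundedness and equicontinuity *)

Theorem proposition4p13 (R : realType)
    (F_ : nat -> pmetricType R) (F : pmetricType R)
    (mu_ : forall n, {measure set (borel (F_ n)) -> \bar R})
    (mu : {measure set (borel F) -> \bar R})
    (E_ : forall n, energy_form R (F_ n)) (E : energy_form R F)
    (Y_ : forall n, hunt_process (F_ n))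
    (p_ : forall n, R -> F_ n -> F_ n -> R)
    (bcF_ : forall n, boundedly_compact (F_ n)) (bcF : boundedly_compact F)
    (rfE_ : forall n, resistance_form (E_ n)) (rfE : resistance_form E)
    (rmE_ : forall n, has_resistance_metric (E_ n))
    (rmE : has_resistance_metric E)
    (recE_ : forall n, recurrent (E_ n)) (recE : recurrent E)
    (radon_mu_ : forall n, radon (mu_ n)) (radon_mu : radon mu)
    (supp_mu_ : forall n, full_support (mu_ n)) (supp_mu : full_support mu)
    (YE_ : forall n, process_of_form (E_ n) (mu_ n) (Y_ n))
    (pY_ : forall n, transition_density (mu_ n) (Y_ n) (p_ n))
    (cont_p_ : forall n, jointly_continuous (p_ n))
    (ghv : ghv_dist (mu_ n) mu @[n --> \oo] --> 0%E)
    (T r : R) (T_gt0 : 0 < T) (r_gt0 : 0 < r) :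
  (ereal_sup (range (fun n => density_sup (p_ n) T r)) < +oo)%E /\
  ereal_sup (range (fun n => density_osc (p_ n) T r delta))
    @[delta --> 0^'+] --> 0%E.
Proof.
have [c c0 cmu] :=
  ghv_cvg_ball_lower_bound F_ F mu_ mu r supp_mu_ supp_mu r_gt0 ghv.
split.
  apply: (@le_lt_trans _ _ (2 * (4 / c + 2 * r / T) + 2 * r / T)%:E);
    last exact: ltry.
  apply: ge_ereal_sup => _ [n _ <-].
  apply: ge_ereal_sup => _ [[[t x] y] [/= Tt xr yr] <-].
  have [S sgS YS] := YE_ n; rewrite lee_fin.
  exact: (density_le (E_ n) (mu_ n) S (Y_ n) (p_ n)).
pose omega delta := 2 * Num.sqrt (delta * ((4 / c + 2 * r / T) / T)) +
  delta * (2 * (4 / c + 4 * r / T) / T).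
have d0 : d @[d --> (0 : R)^'+] --> (0 : R).
  by apply: (@cvg_at_right_filter _ _ (fun d => d)); exact: cvg_id.
have omega0 : omega d @[d --> 0^'+] --> (0 : R).
  rewrite -[X in _ --> X](addr0 (0 : R)); apply: cvgD; last first.
    rewrite -[X in _ --> X](mul0r (2 * (4 / c + 4 * r / T) / T)).
    by apply: cvgM => //; exact: cvg_cst.
  rewrite -[X in _ --> X](mulr0 (2 : R)); apply: cvgM; first exact: cvg_cst.
  rewrite -[X in _ --> X](sqrtr0 R); apply: continuous_cvg.
    exact: sqrt_continuous.
  rewrite -[X in _ --> X](mul0r ((4 / c + 2 * r / T) / T)).
  by apply: cvgM => //; exact: cvg_cst.
apply: (@squeeze_cvge _ _ _ _ (cst 0%E) _ (EFin \o omega)).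
- near=> delta; apply/andP; split.
    apply: (@le_trans _ _ (density_osc (p_ 0%N) T r delta)).
      apply: ereal_sup_ubound.
      exists (T, point, point), (T, point, point).
      have pc : cball (point : F_ 0%N) r point by rewrite /cball /= mdistxx ltW.
      split; [by split|by split| |by rewrite subrr normr0].
      by rewrite /= subrr !mdistxx normr0 !maxxx.
    by apply: ereal_sup_ubound; exists 0%N.
  apply: ge_ereal_sup => _ [n _ <-].
  apply: ge_ereal_sup => _ [[[t x] y] [[[t' x'] y']
    [[/= Tt xr yr] [/= Tt' xr' yr'] + ->]]].
  rewrite /= !ge_max => /andP[td /andP[xd yd]].
  have [S sgS YS] := YE_ n; rewrite lee_fin.
  exact: (density_osc_le (E_ n) (mu_ n) S (Y_ n) (p_ n)).
- exact: cvg_cst.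
- by apply: cvg_EFin => //; exact: nearW.
Unshelve. all: by end_near. Qed.
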